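(* Let $\mathbb{F}$ be a field and let $k\ge2$ be an integer. Let $C_{2k}$ be the cycle with vertices $x_1,\ldots,x_{2k}$ and edges $\{x_1,x_2\},\ldots,\{x_{2k-1},x_{2k}\},\{x_{2k},x_1\}$, and let $W_{2k+1}$ be the wheel graph with vertices $x_1,\ldots,x_{2k+1}$ obtained from $C_{2k}$ by adding the vertex $x_{2k+1}$ and the edges $\{x_i,x_{2k+1}\}$, $1\le i\le 2k$. Then each of $\mathbb{F}[\Delta_k^t(C_{2k})]$ and $\mathbb{F}[\Delta_k^t(W_{2k+1})]$ has a linear resolution, but is not Cohen-Macaulay.
   Context: A simplicial complex on a finite set $V$ is a collection of subsets of $V$ closed under taking subsets (an element of $V$ need not itself be a face). Its Stanley-Reisner ring over $\mathbb{F}$ is $\mathbb{F}[\Delta]=S/I_\Delta$, where $S$ is the polynomial ring over $\mathbb{F}$ with one variable for each $v\in V$ and $I_\Delta$ is generated by the products of the variables over $F$, for all $F\subseteq V$ with $F\notin\Delta$. For a finite simple graph $G=(V,E)$ and a positive integer $k$, $\Delta_k^t(G)$ is the simplicial complex on $V$ whose facets are the complements $V\setminus M$ of the independent sets $M\subseteq V$ of size $k$ (independent: no two elements adjacent). For a homogeneous ideal $I\subseteq S$, $\beta_{i,j}=\dim_{\mathbb{F}}\mathrm{Tor}^S_i(S/I,\mathbb{F})_j$ are the graded Betti numbers of $S/I$. $S/I$ has an $s$-linear resolution if $I$ is generated in degree $s$ and $\beta_{i,j}=0$ whenever $i\ge1$ and $j\ne s+i-1$; it has a linear resolution if it has an $s$-linear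 resolution for some $s\ge 1$. *)

(* Defs.v *)
From HB Require Import structures.
From mathcomp Require Import all_boot all_order all_algebra.
From mathcomp Require Import mpoly.

Set Implicit Arguments.
Unset Strict Implicit.
Unset Printing Implicit Defensive.

Import GRing.Theory.
Local Open Scope ring_scope.

(** * Finite simple graphs *)

Record sgraph (n : nat) := SGraph {
  adj :> rel 'I_n;
  adj_sym : ssrbool.symmetric adj;
  adj_irrefl : irreflexive adj
}.

Definition independent n (G : sgraph n) (M : {set 'I_n}) : bool :=
  [forall u in M, forall v in M, ~~ G u v].

(* [ordS] is the cyclic successor on ['I_n], so the ordinal [i] stands for the
   vertex x_(i+1).  The conjunct [i != j] only matters when n = 1. *)
Definition cycle_rel n : rel 'I_n :=
  fun i j => (i != j) && ((j == ordS i) || (i == ordS j)).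

Fact cycle_rel_sym n : ssrbool.symmetric (@cycle_rel n).
Proof. by move=> i j; rewrite /cycle_rel eq_sym orbC. Qed.

Fact cycle_rel_irrefl n : irreflexive (@cycle_rel n).
Proof. by move=> i; rewrite /cycle_rel eqxx. Qed.

Definition cycle_graph n : sgraph n :=
  SGraph (@cycle_rel_sym n) (@cycle_rel_irrefl n).

(* The new vertex is [ord_max]; [unlift ord_max i] is [Some i'], with [i'] of
   the same value as [i], when [i] is an old vertex, and [None] otherwise. *)
Definition cone_rel n (G : sgraph n) : rel 'I_n.+1 :=
  fun i j => match unlift ord_max i, unlift ord_max j with
             | Some a, Some b => G a b
             | None, None => false
             | _, _ => true
             end.

Fact cone_rel_sym n (G : sgraph n) : ssrbool.symmetric (cone_rel G).
Proof.
move=> i j; rewrite /cone_rel.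
by case: unlift => [a|]; case: unlift => [b|] //; rewrite adj_sym.
Qed.

Fact cone_rel_irrefl n (G : sgraph n) : irreflexive (cone_rel G).
Proof.
by move=> i; rewrite /cone_rel; case: unlift => [a|] //; rewrite adj_irrefl.
Qed.

Definition cone_graph n (G : sgraph n) : sgraph n.+1 :=
  SGraph (cone_rel_sym G) (cone_rel_irrefl G).

(* The wheel with [n] rim vertices, hence [n.+1] vertices in all. *)
Definition wheel_graph n : sgraph n.+1 := cone_graph (cycle_graph n).

(** * Simplicial complexes *)

Record simplicial_complex (n : nat) := SimplicialComplex {
  faces :> {set {set 'I_n}};
  faces_closed : forall A B : {set 'I_n}, B \subset A -> A \in faces -> B \in faces
}.

Definition facet n (D : simplicial_complex n) (A : {set 'I_n}) : bool :=
  maxset (fun B => B \in faces D) A.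

Definition total_cut_faces n (k : nat) (G : sgraph n) : {set {set 'I_n}} :=
  [set A : {set 'I_n} |
    [exists M : {set 'I_n}, [&& independent G M, #|M| == k & A \subset ~: M]]].

Fact total_cut_faces_closed n k (G : sgraph n) (A B : {set 'I_n}) :
  B \subset A -> A \in total_cut_faces k G -> B \in total_cut_faces k G.
Proof.
move=> BA; rewrite !inE => /existsP[M /and3P[iM cM AM]].
by apply/existsP; exists M; rewrite iM cM (subset_trans BA AM).
Qed.

Definition total_cut_complex n (k : nat) (G : sgraph n) : simplicial_complex n :=
  SimplicialComplex (@total_cut_faces_closed n k G).

Lemma facet_total_cut_complex n k (G : sgraph n) (A : {set 'I_n}) :
  facet (total_cut_complex k G) A = independent G (~: A) && (#|~: A| == k).
Proof.
apply/maxsetP/andP => [[]|[iA cA]].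
  rewrite inE => /existsP[M /and3P[iM cM AM]] maxA.
  suff -> : A = ~: M by rewrite setCK.
  apply/esym/maxA => //; rewrite inE; apply/existsP; exists M.
  by rewrite iM cM subxx.
split=> [|B]; rewrite inE.
  by apply/existsP; exists (~: A); rewrite iA cA setCK subxx.
move=> /existsP[M /and3P[iM /eqP cM BM]] AB; apply/esym/eqP.
rewrite eqEcard AB /= (leq_trans (subset_leq_card BM)) //.
rewrite -(leq_add2l #|M|) cardsC cM -(eqP cA) addnC.
by rewrite -{2}(setCK A) -(cardsC A) setCK.
Qed.

(** * Ideals of the polynomial ring *)

Section Algebra.
Variables (F : fieldType) (n : nat).
Local Notation S := {mpoly F[n]}.

Definition ideal_gen (P : S -> Prop) (f : S) : Prop :=
  exists (r : nat) (g h : 'I_r -> S),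
    (forall i, P (g i)) /\ f = \sum_(i < r) h i * g i.

Definition stanley_reisner_ideal (D : simplicial_complex n) : S -> Prop :=
  ideal_gen (fun f => exists A : {set 'I_n},
                        A \notin faces D /\ f = \prod_(v in A) 'X_v).

(** * Graded Betti numbers and linear resolutions *)

(* A graded free resolution ... -> F_1 -> F_0 -> S/I -> 0 by free modules of
   finite rank.  F_i has a basis of [res_rank i] elements, the a-th one in
   degree [res_deg i a]; its elements are row vectors, and [res_diff i] is the
   matrix of F_(i+1) -> F_i, acting on the right.  The map F_0 -> S/I sends the
   l-th basis element to the class of [res_aug l 0].  All maps have degree 0. *)
Record graded_free_resolution (I : S -> Prop) := GradedFreeResolution {
  res_rank : nat -> nat;
  res_deg : forall i : nat, 'I_(res_rank i) -> nat;
  res_diff : forall i : nat, 'M[S]_(res_rank i.+1, res_rank i);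
  res_aug : 'cV[S]_(res_rank 0);
  res_diff_homog : forall i a b m, m \in msupp (res_diff i a b) ->
    (mdeg m + res_deg b = res_deg a)%N;
  res_aug_homog : forall l, res_aug l 0 \is (res_deg l).-homog;
  res_aug_surj : forall f : S,
    exists u : 'rV[S]_(res_rank 0), I (f - (u *m res_aug) 0 0);
  res_exact0 : forall u : 'rV[S]_(res_rank 0),
    I ((u *m res_aug) 0 0) <-> exists v, u = v *m res_diff 0;
  res_exactS : forall i (u : 'rV[S]_(res_rank i.+1)),
    u *m res_diff i = 0 <-> exists v, u = v *m res_diff i.+1
}.

Section Tor.
Variables (I : S -> Prop) (R : graded_free_resolution I).

(* F = S/(x_1, ..., x_n), so tensoring a matrix with F over S amounts to taking
   constant coefficients. *)
Definition tor_diff i : 'M[F]_(res_rank R i.+1, res_rank R i) :=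
  map_mx (mcoeff 0%MM) (res_diff R i).

(* The three matrices below stand for their row spaces, which are subspaces of
   the F-vector space underlying the tensor product of F_i with F. *)
Definition tor_degree i (j : nat) : 'M[F]_(res_rank R i) :=
  diag_mx (\row_a (@res_deg _ R i a == j)%:R).

Definition tor_cycles i : 'M[F]_(res_rank R i) :=
  match i return 'M[F]_(res_rank R i) with
  | 0 => 1%:M
  | i'.+1 => kermx (tor_diff i')
  end.

Definition tor_boundaries i j : 'M[F]_(res_rank R i.+1, res_rank R i) :=
  tor_degree i.+1 j *m tor_diff i.

Definition tor_dim i j : nat :=
  (\rank (tor_degree i j :&: tor_cycles i)%MS - \rank (tor_boundaries i j))%N.

End Tor.

(* dim Tor_i(S/I, F)_j = b.  Tor does not depend on the resolution. *)
Definition betti (I : S -> Prop) (i j b : nat) : Prop :=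
  exists R : graded_free_resolution I, tor_dim R i j = b.

Definition generated_in_degree (I : S -> Prop) (s : nat) : Prop :=
  forall f, I f <-> ideal_gen (fun g => I g /\ g \is s.-homog) f.

Definition s_linear_resolution (I : S -> Prop) (s : nat) : Prop :=
  generated_in_degree I s /\
  forall i j : nat, (1 <= i)%N -> j <> (s + i - 1)%N -> betti I i j 0.

Definition linear_resolution (I : S -> Prop) : Prop :=
  exists s : nat, (1 <= s)%N /\ s_linear_resolution I s.

(** * Cohen-Macaulayness of S/I, for I homogeneous and proper *)

Definition is_ideal (P : S -> Prop) : Prop :=
  P 0 /\ (forall f g, P f -> P g -> P (f + g)) /\ (forall f g, P g -> P (f * g)).

Definition prime_ideal (P : S -> Prop) : Prop :=
  is_ideal P /\ ~ P 1 /\ (forall f g, P (f * g) -> P f \/ P g).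

(* p 0 < ... < p d; primes of S containing I are the primes of S/I. *)
Definition prime_chain (I : S -> Prop) (d : nat) (p : nat -> S -> Prop) : Prop :=
  (forall i, (i <= d)%N -> prime_ideal (p i) /\ (forall f, I f -> p i f)) /\
  (forall i, (i < d)%N ->
     (forall f, p i f -> p i.+1 f) /\ (exists f, p i.+1 f /\ ~ p i f)).

Definition krull_dim (I : S -> Prop) (d : nat) : Prop :=
  (exists p, prime_chain I d p) /\
  (forall e p, prime_chain I e p -> (e <= d)%N).

Definition ideal_add (I : S -> Prop) (s : seq S) : S -> Prop :=
  ideal_gen (fun g => I g \/ g \in s).

Definition regular_sequence (I : S -> Prop) (s : seq S) : Prop :=
  (forall i g, (i < size s)%N ->
     ideal_add I (take i s) (s`_i * g) -> ideal_add I (take i s) g) /\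
  ~ ideal_add I s 1.

Definition in_irrelevant (f : S) : Prop := f@_0%MM = 0.

(* The grade of the irrelevant maximal ideal (x_1, ..., x_n) on S/I. *)
Definition depth (I : S -> Prop) (d : nat) : Prop :=
  (exists s : seq S, size s = d /\ {in s, forall f, in_irrelevant f} /\
     regular_sequence I s) /\
  (forall s : seq S, {in s, forall f, in_irrelevant f} ->
     regular_sequence I s -> (size s <= d)%N).

Definition cohen_macaulay (I : S -> Prop) : Prop :=
  exists d : nat, krull_dim I d /\ depth I d.

End Algebra.

Arguments stanley_reisner_ideal F {n} D _.

(* Main.v *)
Require Import Defs.
From HB Require Import structures.
From mathcomp Require Import all_boot all_algebra.
From mathcomp Require Import mpoly ring.

Set Implicit Arguments.
Unset Strict Implicit.
Unset Printing Implicit Defensive.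

(** The independent sets of size k in C_2k are the even and the odd vertices,
    A and B, and the wheel has the same ones.  So in both cases the ideal I is
    (X_a | a in A) * (X_b | b in B) = (X_a | a in A) :&: (X_b | b in B).

    Resolution: write K(T) for the Koszul complex on the variables in T.  In
    the exact sequence 0 -> K(A) + K(B) -> K(A :|: B) -> Q -> 0 the quotient Q
    is acyclic except at its lowest term, where its homology is I; its
    differentials are linear, and it is free on the subsets of A :|: B meeting
    both A and B.

    Depth: let N = S/(X_a) + S/(X_b), a direct sum, and P = S/(X_a, X_b), so
    that 0 -> S/I -> N -> P -> 0 is exact.  A regular sequence of length 2
    (cycle) or 3 (wheel) on S/I would make the positive Koszul homology of S/I
    vanish; chasing a class of P through this sequence then gives 1 = 0 in P or
    makes the hub variable a unit of P.  The Krull dimension is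
    larger, since I lies in the prime (X_a | a in A). *)

(** * Ideals generated by variables *)

Section Kill.
Import GRing.Theory.
Local Open Scope ring_scope.
Variables (F : fieldType) (n : nat).
Local Notation S := {mpoly F[n]}.
Implicit Types (T U : {set 'I_n}) (f g : S).

(** Constants and variables generate the ring, so identities between ring morphisms need only be
    checked on them. *)
Lemma mpoly_ring_ind (P : S -> Prop) :
  (forall c, P c%:MP) -> (forall i, P 'X_i) ->
  (forall f g, P f -> P g -> P (f + g)) ->
  (forall f g, P f -> P g -> P (f * g)) -> forall f, P f.
Proof.
move=> PC PX PD PM f.
have P1 : P 1 by rewrite -mpolyC1.
have PXn m : P 'X_[m].
  rewrite mpolyXE_id; elim/big_ind: _ => // i _.
  by elim: (m i) => [|e IHe]; rewrite ?expr0 // exprS; apply: PM.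
by rewrite [f]mpolyE; elim/big_ind: _ => [||m _];
  rewrite -?mpolyC0 -?mul_mpolyC //; apply: PM.
Qed.

(** Models the quotient of [S] by the variables in [T] as the polynomials in the other variables:
    ideal membership becomes the equation [kill T f = 0], and classes become elements of [S] fixed
    by [kill T]. *)
Definition kill T : S -> S :=
  mmap (@mpolyC n F) (fun i => if i \in T then 0 else 'X_i).

HB.instance Definition _ T := GRing.RMorphism.copy (kill T)
  (mmap (@mpolyC n F) (fun i => if i \in T then 0 else 'X_i)).

Lemma killC T c : kill T c%:MP = c%:MP.
Proof. exact: mmapC. Qed.

Lemma killX T i : kill T 'X_i = if i \in T then 0 else 'X_i.
Proof. by rewrite /kill mmapX mmap1U. Qed.

Lemma killD T : {morph kill T : f g / f + g}.
Proof. exact: rmorphD. Qed.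

Lemma killB T : {morph kill T : f g / f - g}.
Proof. exact: rmorphB. Qed.

Lemma killM T : {morph kill T : f g / f * g}.
Proof. exact: rmorphM. Qed.

Lemma kill0 T : kill T 0 = 0.
Proof. exact: rmorph0. Qed.

Lemma kill1 T : kill T 1 = 1.
Proof. exact: rmorph1. Qed.

Lemma kill_kill T U f : kill T (kill U f) = kill (T :|: U) f.
Proof.
elim/mpoly_ring_ind: f => [c|i|f g IHf IHg|f g IHf IHg].
- by rewrite !killC.
- by rewrite !killX in_setU orbC; case: ifP; rewrite ?kill0 ?killX.
- by rewrite !killD IHf IHg.
- by rewrite !killM IHf IHg.
Qed.

Lemma kill_setT f : kill setT f = (f@_0%MM)%:MP.
Proof.
elim/mpoly_ring_ind: f => [c|i|f g IHf IHg|f g IHf IHg].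
- by rewrite killC mcoeffC eqxx mulr1.
- by rewrite killX in_setT mcoeffX mnm1_eq0 mpolyC0.
- by rewrite killD IHf IHg mcoeffD mpolyCD.
- by rewrite killM IHf IHg rmorphM mpolyCM.
Qed.

Lemma sub_killE T f : exists h, f - kill T f = \sum_(i in T) 'X_i * h i.
Proof.
elim/mpoly_ring_ind: f => [c|i|f g [h Eh] [h' Eh']|f g [h Eh] [h' Eh']].
- by exists (fun=> 0); rewrite killC subrr big1 // => i _; rewrite mulr0.
- exists (fun j => ((j == i) && (i \in T))%:R); rewrite killX; case: ifP => iT.
    rewrite subr0 (bigD1 i) //= eqxx mulr1 big1 ?addr0 // =>
      j /andP[_ /negPf->].
    by rewrite mulr0.
  by rewrite subrr big1 // => j _; rewrite andbF mulr0.
- exists (fun i => h i + h' i); under eq_bigr do rewrite mulrDr.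
  by rewrite big_split -Eh -Eh' /= killD; ring.
- exists (fun i => h i * g + kill T f * h' i).
  under eq_bigr do rewrite mulrDr mulrA mulrCA.
  by rewrite big_split -mulr_suml -mulr_sumr -Eh -Eh' /= killM; ring.
Qed.

Lemma kill_eq0E T f : kill T f = 0 -> exists h, f = \sum_(i in T) 'X_i * h i.
Proof. by move=> fT; have [h] := sub_killE T f; rewrite fT subr0; exists h. Qed.

Lemma mpolyX_neq0 i : 'X_i != 0 :> S.
Proof.
apply/eqP => /(congr1 (mcoeff U_(i))) /eqP.
by rewrite mcoeffX eqxx mcoeff0 oner_eq0.
Qed.

Lemma kill_prime T : prime_ideal (fun f => kill T f = 0).
Proof.
split; [split; last split|split].
- exact: kill0.
- by move=> f g f0 g0; rewrite killD f0 g0 addr0.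
- by move=> f g g0; rewrite killM g0 mulr0.
- by rewrite kill1; apply/eqP/oner_neq0.
- by move=> f g; rewrite killM => /eqP; rewrite mulf_eq0 => /orP[]/eqP;
    [left|right].
Qed.

Lemma kill1_eq0E i f : kill [set i] f = 0 -> exists g, f = 'X_i * g.
Proof. by case/kill_eq0E=> h ->; rewrite big_set1; exists (h i). Qed.

(** The intersection of the two primes generated by variables; for disjoint [A] and [B] it is also
    their product, by [bip_idealE]. *)
Definition bip_ideal (A B : {set 'I_n}) f := kill A f = 0 /\ kill B f = 0.

(** Expand [f] along the variables of [A]. These survive [kill B], so subtracting [kill B f = 0]
    leaves the coefficients [h a - kill B (h a)], which expand along the variables of [B]. *)
Lemma bip_idealE (A B : {set 'I_n}) f :
  [disjoint A & B] -> bip_ideal A B f ->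
  exists g : 'I_n -> 'I_n ->
    S, f = \sum_(a in A) \sum_(b in B) 'X_a * 'X_b * g a b.
Proof.
move=> dAB [/kill_eq0E[h Ef] fB].
have [g Eg] : exists g : 'I_n -> 'I_n ->
  S, forall a, h a - kill B (h a) = \sum_(b in B) 'X_b * g a b.
  have /fin_all_exists[g Eg] a := sub_killE B (h a).
  by exists g.
exists g; transitivity (f - kill B f); first by rewrite fB subr0.
rewrite Ef rmorph_sum -sumrB; apply: eq_bigr => a aA /=.
rewrite killM killX (disjointFr dAB aA) -mulrBr Eg mulr_sumr.
by apply: eq_bigr => b _; rewrite mulrA.
Qed.

Lemma ideal_gen_min (P Q : S -> Prop) f :
  is_ideal Q -> (forall g, P g -> Q g) -> ideal_gen P f -> Q f.
Proof.
move=> [Q0 [QD QM]] PQ [r [g [h [Pg ->]]]].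
by elim/big_ind: _ => // i _; apply/QM/PQ.
Qed.

Lemma ideal_gen0 (P : S -> Prop) : ideal_gen P 0.
Proof.
by exists 0%N, (fun=> 0), (fun=> 0); split=> [[]//|]; rewrite big_ord0.
Qed.

Lemma ideal_genD (P : S -> Prop) f f' :
  ideal_gen P f -> ideal_gen P f' -> ideal_gen P (f + f').
Proof.
move=> [r [g [h [Pg ->]]]] [r' [g' [h' [Pg' ->]]]]; exists (r + r')%N.
exists (fun i => match split i with inl j => g j | inr j => g' j end).
exists (fun i => match split i with inl j => h j | inr j => h' j end).
split=> [i|]; first by case: split.
rewrite big_split_ord; congr (_ + _); apply: eq_bigr => i _ /=.
  by rewrite -[lshift _ _]/(unsplit (inl _ i)) unsplitK.
by rewrite -[rshift _ _]/(unsplit (inr _ i)) unsplitK.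
Qed.

Lemma ideal_gen_mem (P : S -> Prop) g h : P g -> ideal_gen P (h * g).
Proof.
by move=> Pg; exists 1%N, (fun=> g), (fun=> h); rewrite big_ord1.
Qed.

Lemma bip_ideal_is_ideal (A B : {set 'I_n}) : is_ideal (bip_ideal A B).
Proof.
have [[A0 [AD AM]] _] := kill_prime A; have [[B0 [BD BM]] _] := kill_prime B.
split=> //; split=> [f g [fA fB] [gA gB]|f g [gA gB]].
  by split; [apply: AD | apply: BD].
by split; [apply: AM | apply: BM].
Qed.

Lemma bip_idealX (A B : {set 'I_n}) a b :
  a \in A -> b \in B -> bip_ideal A B ('X_a * 'X_b).
Proof. by move=> aA bB; split; rewrite killM !killX ?aA ?bB ?mul0r ?mulr0. Qed.

Lemma bip_ideal_gen (P : S -> Prop) (A B : {set 'I_n}) f :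
  [disjoint A & B] ->
  (forall a b, a \in A -> b \in B -> P ('X_a * 'X_b)) ->
  bip_ideal A B f -> ideal_gen P f.
Proof.
move=> dAB PX /(bip_idealE dAB)[g ->].
elim/big_ind: _ => [||a aA]; [exact: ideal_gen0|exact: ideal_genD|].
elim/big_ind: _ => [||b bB]; [exact: ideal_gen0|exact: ideal_genD|].
by rewrite mulrC; apply/ideal_gen_mem/PX.
Qed.

(** The nonfaces are the sets meeting both [A] and [B]; each contains a pair [[set a; b]], itself a
    nonface. *)
Lemma stanley_reisner_bip (D : simplicial_complex n) (A B : {set 'I_n}) :
  [disjoint A & B] ->
  (forall N, (N \in faces D) = [disjoint N & A] || [disjoint N & B]) ->
  forall f, stanley_reisner_ideal F D f <-> bip_ideal A B f.
Proof.
move=> dAB facesD f; split; last first.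
  apply: bip_ideal_gen => // a b aA bB; exists [set a; b]; split.
    rewrite facesD; apply/norP.
    by split; apply/pred0Pn; [exists a|exists b]; rewrite /= !inE eqxx ?orbT.
  rewrite big_setU1 ?big_set1 // inE.
  by apply/eqP => ab; move: bB; rewrite -ab (disjointFr dAB aA).
apply: ideal_gen_min => [|g [N [+ ->]]]; first exact: bip_ideal_is_ideal.
rewrite facesD negb_or =>
  /andP[/pred0Pn[a /andP[/= aN aA]] /pred0Pn[b /andP[/= bN bB]]].
split; rewrite rmorph_prod /=; [rewrite (bigD1 a)|rewrite (bigD1 b)] => //=.
  by rewrite killX aA mul0r.
by rewrite killX bB mul0r.
Qed.

Lemma bip_generated_in_degree (A B : {set 'I_n}) :
  [disjoint A & B] -> generated_in_degree (bip_ideal A B) 2.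
Proof.
move=> dAB f; split; last first.
  by apply: ideal_gen_min => [|g []//]; apply: bip_ideal_is_ideal.
apply: bip_ideal_gen => // a b aA bB; split; first exact: bip_idealX.
by rewrite -mpolyXD dhomogX /= mdegD !mdeg1.
Qed.

End Kill.

(** * Regular sequences *)

Section Depth.
Import GRing.Theory.
Local Open Scope ring_scope.

(** In the applications [a], [a'] are values of [kill A] and [c], [c'] values of [kill (A :|: B)],
    whose cross relation with [w], [w'] holds in P. *)
Lemma cross_sub (R : comNzRingType) (a a' c c' w w' m m' : R) :
  (a - c) * w - (a' - c') * w' - (a * m - a' * m') = 0 ->
  c * w = c' * w' -> a * (w - m) = a' * (w' - m').
Proof.
move=> E0 Ew; apply/eqP; rewrite -subr_eq0 -E0 -subr_eq0; apply/eqP.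
by rewrite !mulrBl Ew; ring.
Qed.

Lemma cross_sub0 (R : comNzRingType) (a a' w w' m m' : R) :
  0 * w - 0 * w' - (a * m - a' * m') = 0 -> a * m = a' * m'.
Proof.
by move=> E0; apply/eqP; rewrite -subr_eq0 -oppr_eq0 -E0; apply/eqP; ring.
Qed.

(** This is the 3 by 3 determinant with rows a, a - c and w: the repeated row a contributes nothing,
    and all minors of c and w vanish. *)
Lemma cross_cycle (R : comNzRingType) (a1 a2 a3 c1 c2 c3 w1 w2 w3 : R) :
  c1 * w2 = c2 * w1 -> c1 * w3 = c3 * w1 -> c2 * w3 = c3 * w2 ->
  a1 * ((a2 - c2) * w3 - (a3 - c3) * w2) - a2 * ((a1 - c1) * w3 - (a3 - c3) *
    w1)
    + a3 * ((a1 - c1) * w2 - (a2 - c2) * w1) = 0.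
Proof.
move=> E12 E13 E23; transitivity (a2 * (c1 * w3 - c3 * w1)
  - a1 * (c2 * w3 - c3 * w2) - a3 * (c1 * w2 - c2 * w1)); first by ring.
by rewrite E12 E13 E23 !subrr; ring.
Qed.

Variables (F : fieldType) (n : nat).
Local Notation S := {mpoly F[n]}.
Implicit Types (T U : {set 'I_n}) (f g m s t v w x y : S).

Lemma ideal_gen_is_ideal (P : S -> Prop) : is_ideal (ideal_gen P).
Proof.
split; [exact: ideal_gen0|split; first exact: ideal_genD].
move=> f _ [r [g [h [Pg ->]]]]; exists r, g, (fun i => f * h i); split=> //.
by rewrite mulr_sumr; apply: eq_bigr => i _; rewrite mulrA.
Qed.

Lemma ideal_add_nil (I : S -> Prop) f :
  is_ideal I -> ideal_add I [::] f <-> I f.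
Proof.
move=> idI; split=> [|If]; first by apply: ideal_gen_min => // g [].
by rewrite -[f]mul1r; apply: ideal_gen_mem; left.
Qed.

Lemma ideal_add_cons (I : S -> Prop) f l g :
  ideal_add I (f :: l) g <-> exists m, ideal_add I l (g - m * f).
Proof.
have [_ [addD addM]] := ideal_gen_is_ideal (fun g => I g \/ g \in l).
split=> [|[m gmf]].
  apply: (@ideal_gen_min _ _ _ (fun g =>
    exists m, ideal_add I l (g - m * f))) => [|h].
    split; [|split] => [|f1 f2 [m1 I1] [m2 I2]|f1 f2 [m I2]].
    - by exists 0; rewrite mul0r subr0; apply: ideal_gen0.
    - exists (m1 + m2); suff ->
        : f1 + f2 - (m1 + m2) * f = (f1 - m1 * f) + (f2 - m2 * f) by exact:
          addD.
      by ring.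
    - exists (f1 * m); suff ->
        : f1 * f2 - f1 * m * f = f1 * (f2 - m * f) by exact: addM.
      by ring.
  have mem p : I p \/ p \in l -> ideal_add I l p.
    by move=> Ip; rewrite -[p]mul1r; apply: ideal_gen_mem.
  case=> [Ih|]; first by exists 0; rewrite mul0r subr0; apply: mem; left.
  rewrite inE => /predU1P[->|hl].
    by exists 1; rewrite mul1r subrr; apply: ideal_gen0.
  by exists 0; rewrite mul0r subr0; apply: mem; right.
rewrite -[g](subrK (m * f)); apply: ideal_genD.
  apply: ideal_gen_min gmf => [|h Ih]; first exact: ideal_gen_is_ideal.
  rewrite -[h]mul1r; apply: ideal_gen_mem.
  by case: Ih; [left|right; rewrite inE; apply/orP; right].
by apply: ideal_gen_mem; right; apply: mem_head.
Qed.

Lemma regular_sequence1 (I : S -> Prop) f1 l g : is_ideal I ->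
  regular_sequence I (f1 :: l) -> I (f1 * g) -> I g.
Proof.
move=> idI [reg _] If1g; apply/(ideal_add_nil _ idI).
by apply: (reg 0%N) => //; apply/ideal_add_nil.
Qed.

Lemma regular_sequence2 (I : S -> Prop) f1 f2 l g m : is_ideal I ->
  regular_sequence I [:: f1, f2 & l] -> I (f2 * g - m * f1) ->
  exists m', I (g - m' * f1).
Proof.
move=> idI [reg _] Ig.
have := reg 1%N g isT; rewrite /= ?take0 => /(_ _)/ideal_add_cons[].
  by apply/ideal_add_cons; exists m; apply/ideal_add_nil.
by move=> m' /(ideal_add_nil _ idI); exists m'.
Qed.

Lemma regular_sequence3 (I : S -> Prop) f1 f2 f3 l g m1 m2 : is_ideal I ->
  regular_sequence I [:: f1, f2, f3 & l] -> I (f3 * g - m1 * f1 - m2 * f2) ->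
  exists m1' m2', I (g - m1' * f1 - m2' * f2).
Proof.
move=> idI [reg _] Ig.
have := reg 2%N g isT; rewrite /= ?take0 => /(_ _)/ideal_add_cons[].
  by apply/ideal_add_cons; exists m1; apply/ideal_add_cons; exists m2;
    apply/ideal_add_nil.
by move=> m1' /ideal_add_cons[m2' /(ideal_add_nil _ idI)]; exists m1', m2'.
Qed.

Lemma ideal_gen_mono (P Q : S -> Prop) f :
  (forall g, P g -> Q g) -> ideal_gen P f -> ideal_gen Q f.
Proof. by move=> PQ [r [g [h [Pg ->]]]]; exists r, g, h; split=> // i;
  apply: PQ. Qed.

Lemma eq_regular_sequence (I J : S -> Prop) (s : seq S) :
  (forall f, I f <-> J f) -> regular_sequence I s -> regular_sequence J s.
Proof.
move=> IJ [reg proper].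
have addIJ l f : ideal_add I l f <-> ideal_add J l f.
  by split; apply: ideal_gen_mono => g [/IJ|]; [left|right|left|right].
by split=> [i g lti /addIJ/(reg _ _ lti)/addIJ|/addIJ].
Qed.

(* H_1 = 0 for the Koszul complex on [S / I] of [f1, f2] and, in the next lemma,
   of [f1, f2, f3]. *)
Lemma regular_sequence_minors (I : S -> Prop) f1 f2 l w1 w2 : is_ideal I ->
  regular_sequence I [:: f1, f2 & l] -> I (f1 * w2 - f2 * w1) ->
  exists m, I (w1 - f1 * m) /\ I (w2 - f2 * m).
Proof.
move=> idI reg Iw; have [_ [ID IM]] := idI.
have [|m Im] := @regular_sequence2 _ _ _ _ w1 w2 idI reg.
  by have := IM (-1) _ Iw; congr (I _); ring.
exists m; split; first by move: Im; congr (I _); ring.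
apply: (regular_sequence1 idI reg).
by have := ID _ _ Iw (IM f2 _ Im); congr (I _); ring.
Qed.

Lemma regular_sequence_syzygy (I : S -> Prop) f1 f2 f3 l v12 v13 v23 :
  is_ideal I -> regular_sequence I [:: f1, f2, f3 & l] ->
  I (f1 * v23 - f2 * v13 + f3 * v12) ->
  exists m1 m2 m3, [/\ I (v12 - (f1 * m2 - f2 * m1)),
    I (v13 - (f1 * m3 - f3 * m1)) & I (v23 - (f2 * m3 - f3 * m2))].
Proof.
move=> idI reg Iv; have [_ [ID IM]] := idI.
have [|m2 [m1 Im]] := @regular_sequence3 _ _ _ _ _ v12 (- v23) v13 idI reg.
  by move: Iv; congr (I _); ring.
have [|m3 [Im1 Im2]] := @regular_sequence_minors _ f1 f2 _
    (v13 - f3 * m1) (v23 + f3 * m2) idI reg.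
  by have := ID _ _ Iv (IM (- f3) _ Im); congr (I _); ring.
exists (- m1), m2, m3; split.
- by move: Im; congr (I _); ring.
- by move: Im1; congr (I _); ring.
- by move: Im2; congr (I _); ring.
Qed.

(** A first term in the ideal (X_a | a in A) would be annihilated by ['X_b] modulo the bipartite
    ideal, which does not contain ['X_b]. *)
Lemma regular_kill_neq0 (A B : {set 'I_n}) f l b :
  [disjoint A & B] -> b \in B ->
  regular_sequence (bip_ideal A B) (f :: l) -> kill A f != 0.
Proof.
move=> dAB bB reg; apply/eqP => fA.
have [|/eqP] := regular_sequence1 (g := 'X_b) (bip_ideal_is_ideal F A B) reg.
  by split; rewrite killM ?fA ?mul0r // killX bB mulr0.
by rewrite killX (disjointFl dAB bB) (negPf (mpolyX_neq0 _ _)).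
Qed.

Lemma killUE (A B : {set 'I_n}) f : kill B (kill A f) = kill (A :|: B) f.
Proof. by rewrite kill_kill setUC. Qed.

Lemma kill_id T f : kill T (kill T f) = kill T f.
Proof. by rewrite kill_kill setUid. Qed.

Lemma bip_ideal_sym (A B : {set 'I_n}) f : bip_ideal A B f -> bip_ideal B A f.
Proof. by case. Qed.

(** The class 1 of P lifts to (1, 0) in N. Multiplied by f1 and f2, which vanish in P, it gives a
    Koszul cycle on S/I. Writing this cycle as [m] times (f1, f2) forces [m] to be 1 modulo the
    ideal of [A] and 0 modulo that of [B]. *)
Lemma no_regular_sequence2 (A B : {set 'I_n}) f1 f2 l :
  [disjoint A & B] -> A != set0 -> B != set0 ->
  kill (A :|: B) f1 = 0 -> kill (A :|: B) f2 = 0 ->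
  ~ regular_sequence (bip_ideal A B) [:: f1, f2 & l].
Proof.
move=> dAB /set0Pn[a aA] /set0Pn[b bB] f10 f20 reg.
have nzA := regular_kill_neq0 dAB bB reg.
have [|m [+ _]] := @regular_sequence_minors _ f1 f2 l (kill A f1) (kill A f2)
    (bip_ideal_is_ideal F A B) reg.
  split; rewrite killB !killM ?kill_id ?killUE ?f10 ?f20; ring.
case; rewrite !killB !killM kill_id killUE f10 sub0r => E1 /eqP.
have {}E1 : 1 - kill A m = 0.
  by apply: (mulfI nzA); rewrite mulr0 -E1; ring.
rewrite oppr_eq0 mulf_eq0 => /orP[/eqP fB|/eqP mB].
  have regBA : regular_sequence (bip_ideal B A) [:: f1, f2 & l].
    by apply: eq_regular_sequence reg => f; split; apply: bip_ideal_sym.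
  have := regular_kill_neq0 _ aA regBA.
  by rewrite disjoint_sym fB eqxx => /(_ dAB).
(* In P the element [m] is both 1 and 0. *)
move/(congr1 (kill B)): E1;
  rewrite killB kill1 kill0 /= killUE -kill_kill mB kill0.
by rewrite subr0 => /eqP; rewrite oner_eq0.
Qed.

Lemma kill_sub_id T U f : T \subset U -> kill U f = f -> kill T f = f.
Proof. by move=> /setUidPr TU <-; rewrite kill_kill TU. Qed.

(* [kill A w1 = w1] says that [w1] lies in the polynomial ring in the variables
   outside [A], which is [S / (X_a | a in A)]. *)
Lemma regular_kill_proportional (A B : {set 'I_n}) f1 f2 l w1 w2 b b' :
  [disjoint A & B] -> b \in B -> b' \in B -> b != b' ->
  regular_sequence (bip_ideal A B) [:: f1, f2 & l] ->
  kill A w1 = w1 -> kill A w2 = w2 -> kill A f1 * w2 = kill A f2 * w1 ->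
  exists s, w1 = kill A f1 * s.
Proof.
move=> dAB bB b'B bb' reg w1A w2A Ew.
have nzA := regular_kill_neq0 dAB bB reg.
(* Multiplication by ['X_c] makes the relation hold modulo both primes, so that H_1 = 0 on S/I
   applies to it. *)
have mult c : c \in B -> exists m, 'X_c * w1 = kill A f1 * m.
  move=> cB; have killAX : kill A 'X_c = 'X_c :> S.
    by rewrite killX (disjointFl dAB cB).
  have [|m [[+ _] _]] := @regular_sequence_minors _ f1 f2 l ('X_c * w1)
      ('X_c * w2) (bip_ideal_is_ideal F A B) reg.
    split; rewrite killB !killM ?killAX ?w1A ?w2A; last first.
      by rewrite killX cB; ring.
    by rewrite mulrCA Ew mulrCA subrr.
  rewrite killB !killM killAX w1A => /eqP.
  by rewrite subr_eq0 => /eqP; exists (kill A m).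
have [m Em] := mult b bB; have [m' Em'] := mult b' b'B.
(* Comparing two distinct variables: ['X_b] divides ['X_b' * m], hence it divides [m]. *)
have Emm : 'X_b' * m = 'X_b * m'.
  by apply: (mulfI nzA); rewrite [LHS]mulrCA -Em [RHS]mulrCA -Em' mulrCA.
have /kill1_eq0E[s Es] : kill [set b] m = 0.
  have /(congr1 (kill [set b])) := Emm.
  rewrite !killM !killX !inE eqxx eq_sym (negPf bb') mul0r => /eqP.
  by rewrite mulf_eq0 (negPf (mpolyX_neq0 _ _)) => /eqP.
exists s; apply: (mulfI (mpolyX_neq0 F b)).
by rewrite Em Es mulrCA.
Qed.

(** This is H_1 = 0 for the Koszul complex of f1, f2, f3 on P, obtained through the connecting map.
    Lift w to (w, 0) in N; its differential comes from a 2-cycle on S/I, which is the boundary of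
    some m. Subtracting m leaves a cycle on each summand of N, hence multiples of f by some [s] and
    [t], and in P w is f times s + t. *)
Lemma regular_kill_proportional3 (A B : {set 'I_n}) f1 f2 f3 l w1 w2 w3 :
  [disjoint A & B] -> (1 < #|A|)%N -> (1 < #|B|)%N ->
  regular_sequence (bip_ideal A B) [:: f1, f2, f3 & l] ->
  kill (A :|: B) w1 = w1 -> kill (A :|: B) w2 = w2 -> kill (A :|: B) w3 = w3 ->
  kill (A :|: B) f1 * w2 = kill (A :|: B) f2 * w1 ->
  kill (A :|: B) f1 * w3 = kill (A :|: B) f3 * w1 ->
  kill (A :|: B) f2 * w3 = kill (A :|: B) f3 * w2 ->
  exists s, [/\ w1 = kill (A :|: B) f1 * s, w2 = kill (A :|: B) f2 * s
            & w3 = kill (A :|: B) f3 * s].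
Proof.
move=> dAB /card_gt1P[a [a' [aA a'A aa']]] /card_gt1P[b [b' [bB b'B bb']]] reg.
move=> w1J w2J w3J Ew12 Ew13 Ew23.
have regBA : regular_sequence (bip_ideal B A) [:: f1, f2, f3 & l].
  by apply: eq_regular_sequence reg => f; split; apply: bip_ideal_sym.
have dBA : [disjoint B & A] by rewrite disjoint_sym.
have nzA := regular_kill_neq0 dAB bB reg.
have nzB := regular_kill_neq0 dBA aA regBA.
have idA w : kill (A :|: B) w = w -> kill A w = w.
  exact: (kill_sub_id (subsetUl A B)).
have wA := (idA _ w1J, idA _ w2J, idA _ w3J).
(* [q f] vanishes modulo the ideal of [B]; modulo that of [A] it differs from [f] by the class of
   [f] in P, whose cross relations with w hold. *)
have [q [qA qB qE]] : exists q : S -> S, [/\ forall f, kill A (q f) = q f,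
    forall f, kill B (q f) = 0 & forall f, q f = kill A f - kill (A :|: B) f].
  exists (fun f => kill A f - kill (A :|: B) f); split=> // f.
    by rewrite killB kill_id kill_kill setUA setUid.
  by rewrite killB killUE kill_kill setUCA setUid subrr.
have [|m1 [m2 [m3 []]]] := @regular_sequence_syzygy _ f1 f2 f3 l
    (q f1 * w2 - q f2 * w1) (q f1 * w3 - q f3 * w1) (q f2 * w3 - q f3 * w2)
    (bip_ideal_is_ideal F A B) reg.
  split; rewrite !(killB, killD, killM) /= ?qA ?qB; last by ring.
  rewrite !wA !qE.
  exact: cross_cycle.
rewrite /bip_ideal !(killB, killM) /= !qA !qB !wA !qE.
move=> [EA12 EB12] [EA13 EB13] [EA23 EB23].
have [s Es] : exists s, w1 - kill A m1 = kill A f1 * s.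
  apply: (@regular_kill_proportional A B f1 f2 _ _ (w2 - kill A m2) b b' dAB bB
    b'B bb' reg).
  - by rewrite killB kill_id !wA.
  - by rewrite killB kill_id !wA.
  exact: cross_sub EA12 Ew12.
have [t Et] : exists t, kill B m1 = kill B f1 * t.
  apply: (@regular_kill_proportional B A f1 f2 _ _ (kill B m2) a a' dBA aA a'A
    aa' regBA).
  - by rewrite kill_id.
  - by rewrite kill_id.
  exact: cross_sub0 EB12.
have propA f w m : kill A f1 * (w - kill A m) = kill A f * (w1 - kill A m1) ->
    w - kill A m = kill A f * s.
  by rewrite Es mulrCA => /(mulfI nzA).
have propB f m : kill B f1 * kill B m = kill B f * kill B m1 ->
    kill B m = kill B f * t.
  by rewrite Et mulrCA => /(mulfI nzB).
have fin f w m : kill (A :|: B) w = w -> w - kill A m = kill A f * s ->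
    kill B m = kill B f * t -> w = kill (A :|: B) f * (kill B s + kill A t).
  move=> wJ /(congr1 (kill B)) + /(congr1 (kill A)).
  rewrite killB !killM !kill_kill ![B :|: A]setUC (kill_sub_id (subsetUr A B)
    wJ).
  by move=> Ew Em; rewrite mulrDr -Ew -Em; ring.
exists (kill B s + kill A t); split; apply: fin => //; try exact: Es;
  try exact: Et.
- by apply: propA; exact: cross_sub EA12 Ew12.
- by apply: propB; exact: cross_sub0 EB12.
- by apply: propA; exact: cross_sub EA13 Ew13.
- by apply: propB; exact: cross_sub0 EB13.
Qed.

(** Here P is the polynomial ring in the hub variable. Dividing the classes of f1, f2, f3 by ['X_h]
    gives another cycle, so each quotient satisfies [g = 'X_h * g * s]. Hence all of them vanish,
    and then (1, 0, 0) is a cycle that is no multiple of (0, 0, 0). *)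
Lemma no_regular_sequence3 (A B : {set 'I_n}) h f1 f2 f3 l :
  [disjoint A & B] -> (1 < #|A|)%N -> (1 < #|B|)%N -> ~: (A :|: B) = [set h] ->
  in_irrelevant f1 -> in_irrelevant f2 -> in_irrelevant f3 ->
  ~ regular_sequence (bip_ideal A B) [:: f1, f2, f3 & l].
Proof.
move=> dAB cA cB hubE f10 f20 f30 reg.
have hJ : h \notin A :|: B by rewrite -in_setC hubE set11.
(* Killing the hub as well leaves the constant coefficient of [f], which is zero. *)
have div f : in_irrelevant f ->
  exists g, kill (A :|: B) f = 'X_h * g /\ kill (A :|: B) g = g.
  move=> f0; have /kill1_eq0E[g Eg] : kill [set h] (kill (A :|: B) f) = 0.
    by rewrite kill_kill -hubE setUC setUCr kill_setT f0.
  exists g; split=> //; apply: (mulfI (mpolyX_neq0 F h)); rewrite -Eg.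
  by move/(congr1 (kill (A :|: B))): Eg; rewrite kill_id killM killX (negPf hJ).
have [g1 [E1 g1J]] := div _ f10; have [g2 [E2 g2J]] := div _ f20.
have [g3 [E3 g3J]] := div _ f30.
have key w1 w2 w3 := regular_kill_proportional3 (w1 := w1) (w2 := w2) (w3 :=
  w3) dAB cA cB reg.
rewrite E1 E2 E3 in key.
have [s [Es1 Es2 Es3]] : exists s, [/\ g1 = 'X_h * g1 * s, g2 = 'X_h * g2 * s &
  g3 = 'X_h * g3 * s].
  by apply: key => //; ring.
(* Otherwise ['X_h] would be a unit, and setting it to 0 would give 1 = 0. *)
have gz g : g = 'X_h * g * s -> g = 0.
  move=> Eg; apply: contraTeq (oner_neq0 S) => nzg; rewrite negbK.
  have /(congr1 (kill [set h])) : 1 = 'X_h * s.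
    by apply: (mulfI nzg); rewrite mulr1 mulrCA mulrA.
  by rewrite kill1 killM killX set11 mul0r => ->.
rewrite (gz _ Es1) (gz _ Es2) (gz _ Es3) !mulr0 in key.
have [||||||t [/eqP]] := key 1 0 0; rewrite ?kill1 ?kill0 ?mul0r ?mulr0 //.
by rewrite oner_eq0.
Qed.
End Depth.

(** * Failure of the Cohen-Macaulay property *)

Section NotCM.
Import GRing.Theory.
Local Open Scope ring_scope.
Variables (F : fieldType) (n : nat).
Local Notation S := {mpoly F[n]}.

Lemma kill_subset (T U : {set 'I_n}) (f : S) : T \subset U ->
  kill T f = 0 -> kill U f = 0.
Proof. by move=> /setUidPl <- fT; rewrite -kill_kill fT kill0. Qed.

(** The chain starts at the prime (X_i | i in A) and adjoins the variables of [s] one at a time. *)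
Lemma krull_dim_ge (I : S -> Prop) (A : {set 'I_n}) (s : seq 'I_n) d :
  (forall f, I f -> kill A f = 0) -> uniq s -> {in s, forall i, i \notin A} ->
  krull_dim I d -> (size s <= d)%N.
Proof.
move=> IA s_uniq sA [_ maxd]; pose T i := A :|: [set x in take i s].
apply: (maxd _ (fun i f => kill (T i) f = 0)); split=> i lti.
  by split=> [|f /IA]; [exact: kill_prime | apply/kill_subset/subsetUl].
have x0 : 'I_n by case: (s) lti.
split=> [f|].
  apply/kill_subset/setUS/subsetP => x; rewrite !inE (take_nth x0 lti).
  by rewrite mem_rcons inE orbC => ->.
exists 'X_(nth x0 s i); rewrite !killX !inE (take_nth x0 lti).
rewrite mem_rcons mem_head orbT; split=> //.
rewrite (negPf (sA _ _)) ?mem_nth //= in_take ?mem_nth // index_uniq // ltnn.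
by apply/eqP/mpolyX_neq0.
Qed.

(** The chain adjoining [b] and [b'] makes the dimension at least 2, while P is the field F, in
    which every element of the irrelevant ideal vanishes. *)
Lemma bip_not_cohen_macaulay2 (I : S -> Prop) (A B : {set 'I_n}) :
  (forall f, I f <-> bip_ideal A B f) ->
  [disjoint A & B] -> (1 < #|A|)%N -> (1 < #|B|)%N -> A :|: B = setT ->
  ~ cohen_macaulay I.
Proof.
move=> IE dAB cA /card_gt1P[b [b' [bB b'B bb']]] AB [d [kd [[s [szs [s0 reg]]]
  _]]].
have lt1d : (2 <= d)%N.
  apply: (@krull_dim_ge I A [:: b; b']) kd => [f /IE[]//||x].
    by rewrite /= inE bb'.
  by rewrite !inE => /orP[]/eqP->; rewrite (disjointFl dAB).
case: s szs s0 reg => [|f1 [|f2 s]] /=; try by move=> sz; rewrite -sz in lt1d.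
move=> _ s0 /(eq_regular_sequence IE); apply: no_regular_sequence2 => //.
- by rewrite -card_gt0 ltnW.
- by apply/set0Pn; exists b.
- by rewrite AB kill_setT s0 ?inE ?eqxx // mpolyC0.
- by rewrite AB kill_setT s0 ?inE ?eqxx ?orbT // mpolyC0.
Qed.

(** The hub lengthens the chain to [b], [b'], [h], so equality of depth and dimension would need a
    regular sequence with at least three terms. *)
Lemma bip_not_cohen_macaulay3 (I : S -> Prop) (A B : {set 'I_n}) h :
  (forall f, I f <-> bip_ideal A B f) ->
  [disjoint A & B] -> (1 < #|A|)%N -> (1 < #|B|)%N -> ~: (A :|: B) = [set h] ->
  ~ cohen_macaulay I.
Proof.
move=> IE dAB cA cB hubE [d [kd [[s [szs [s0 reg]]] _]]].
have := cB => /card_gt1P[b [b' [bB b'B bb']]].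
have : h \notin A :|: B by rewrite -in_setC hubE set11.
rewrite in_setU negb_or => /andP[hA hB].
have lt2d : (3 <= d)%N.
  apply: (@krull_dim_ge I A [:: b; b'; h]) kd => [f /IE[]//||x].
    by rewrite /= !inE negb_or bb' !(contraNneq _ hB) // => <-.
  by rewrite !inE => /or3P[]/eqP->; rewrite // (disjointFl dAB).
case: s szs s0 reg => [|f1 [|f2 [|f3 s]]] /=; try by move=> sz;
  rewrite -sz in lt2d.
move=> _ s0 /(eq_regular_sequence IE).
by apply: (no_regular_sequence3 dAB cA cB hubE); apply: s0;
  rewrite !inE eqxx ?orbT.
Qed.

End NotCM.

(** * Koszul complexes *)

Section Koszul.
Import GRing.Theory.
Local Open Scope ring_scope.
Variables (F : fieldType) (n : nat).
Local Notation S := {mpoly F[n]}.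
Local Notation L := {ffun {set 'I_n} -> S}.
Implicit Types (A r : {set 'I_n}) (z w : L) (u v : 'I_n).

(** The terms for (u, v) and (v, u) cancel; splitting at u < v keeps the argument valid in
    characteristic 2. *)
Lemma big_antisym (V : zmodType) (P : rel 'I_n) (t : 'I_n -> 'I_n -> V) :
  ssrbool.symmetric P -> irreflexive P ->
  (forall u v, P u v -> t u v = - t v u) ->
  \sum_u \sum_(v | P u v) t u v = 0.
Proof.
move=> Psym Pirr t_anti;
  rewrite pair_big_dep /= (bigID (fun p : 'I_n * 'I_n => (p.1 < p.2)%N)) /=.
rewrite [X in _ + X](reindex_inj (h := fun p : 'I_n * 'I_n => (p.2, p.1))) /=;
  last first.
  by move=> [a b] [c d] [-> ->].
rewrite [X in _ + X](eq_bigl (fun p => P p.1 p.2 && (p.1 < p.2)%N)); last first.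
  move=> [a b] /=; rewrite Psym; case Pab: (P a b) => //=.
  rewrite -leqNgt leq_eqVlt; case: eqP => // /val_inj ab.
  by rewrite ab Pirr in Pab.
by rewrite -big_split big1 // => -[a b] /andP[Pab _] /=;
  rewrite t_anti // addNr.
Qed.

(** The sign of e_v wedge e_r when the factors of basis elements of the exterior algebra are in
    increasing order. *)
Definition ksign v r : S := (-1) ^+ #|[set w in r | (w < v)%N]|.

Lemma ksign_sqr v r : ksign v r * ksign v r = 1.
Proof. by rewrite -expr2 sqrr_sign. Qed.

Lemma ksignU u v r : v \notin r ->
  ksign u (v |: r) = (-1) ^+ (v < u)%N * ksign u r.
Proof.
move=> vr; rewrite /ksign -exprD; congr (_ ^+ _).
case: ltnP => vu /=.
  rewrite (_ : [set w in _ | _] = v |: [set w in r | (w < u)%N]).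
    by rewrite cardsU1 inE (negPf vr).
  by apply/setP => w; rewrite !inE andb_orl; case: eqP => // ->; rewrite vu.
apply: eq_card => w; rewrite !inE andb_orl; case: eqP => //= ->.
by rewrite ltnNge vu (negPf vr).
Qed.

Lemma ksign_swap u v r : u != v -> u \notin r -> v \notin r ->
  ksign u r * ksign v (u |: r) = - (ksign v r * ksign u (v |: r)).
Proof.
move=> uv ur vr; rewrite !ksignU //.
have -> : (-1) ^+ (u < v)%N = - (-1) ^+ (v < u)%N :> S; last by ring.
case: (ltngtP u v) uv => [||/val_inj->]; rewrite ?eqxx //= expr1 expr0 //.
by rewrite opprK.
Qed.

(** An element of [L] lists the coefficients [z r] on the basis of the exterior algebra, in all
    degrees at once; the complex K(T) is cut out by [carried T]. *)
Definition koszul z : L :=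
  [ffun r : {set 'I_n} => \sum_(v | v \notin r) ksign v r * 'X_v * z (v |: r)].

Lemma koszulB z w : koszul (z - w) = koszul z - koszul w.
Proof.
apply/ffunP => r; rewrite !ffunE -sumrB; apply: eq_bigr => v _.
by rewrite !ffunE mulrBr.
Qed.

Lemma koszul0 : koszul 0 = 0.
Proof. by rewrite -[0 in LHS](subrr 0) koszulB subrr. Qed.

Lemma koszulN z : koszul (- z) = - koszul z.
Proof. by rewrite -sub0r koszulB koszul0 sub0r. Qed.

Lemma koszulD z w : koszul (z + w) = koszul z + koszul w.
Proof. by rewrite -[w in LHS]opprK koszulB koszulN opprK. Qed.

Lemma koszul_koszul z : koszul (koszul z) = 0.
Proof.
apply/ffunP => r; rewrite !ffunE big_mkcond /=.
transitivity (\sum_u \sum_(v | [&& u != v, u \notin r & v \notin r])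
   ksign u r * 'X_u * (ksign v (u |: r) * 'X_v * z (v |: (u |: r)))).
  apply: eq_bigr => u _; case: ifP => ur; last by rewrite big1 // => v;
    rewrite andbF.
  rewrite ffunE mulr_sumr; apply: eq_bigl => v.
  by rewrite !inE negb_or eq_sym.
apply: big_antisym => [u v|u|u v /and3P[uv ur vr]].
- by rewrite /= eq_sym [(u \notin r) && _]andbC.
- by rewrite eqxx.
rewrite [in RHS]setUCA.
transitivity (ksign u r * ksign v (u |: r) * ('X_u * 'X_v * z (v |: (u |: r)))).
  by ring.
by rewrite (ksign_swap uv ur vr); ring.
Qed.

Definition carried A z := forall r, ~~ (r \subset A) -> z r = 0.

Lemma koszul_carried A z : carried A z -> carried A (koszul z).
Proof.
move=> zA r rA; rewrite ffunE big1 // => v _; rewrite zA ?mulr0 //.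
by apply: contra rA; apply: subset_trans; apply: subsetUr.
Qed.

Lemma koszul_set0 A z : carried A z ->
  koszul z set0 = \sum_(v in A) 'X_v * z [set v].
Proof.
move=> zA; rewrite ffunE [LHS](bigID (mem A)) /= [X in _ + X]big1 ?addr0;
  last first.
  by move=> v /andP[_ vA]; rewrite zA ?mulr0 // setU0 sub1set.
apply: eq_big => [v|v _]; first by rewrite inE.
rewrite setU0 /ksign (_ : [set w in set0 | _] = set0) ?cards0 ?mul1r //.
by apply/setP => w; rewrite !inE.
Qed.

(** Writing z = z' + e_v wedge c with z' and c free of e_v, this is c. *)
Definition contraction v z : L :=
  [ffun r : {set 'I_n} => if v \in r then 0 else ksign v r * z (v |: r)].

Definition wedge v z : L :=
  [ffun r : {set 'I_n} => if v \in r then ksign v (r :\ v) * z (r :\ v) else 0].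

Lemma koszul_contraction v z : koszul z = 0 -> koszul (contraction v z) = 0.
Proof.
move=> dz; apply/ffunP => r; rewrite ffunE [RHS]ffunE.
case vr: (v \in r).
  by rewrite big1 // => u _; rewrite ffunE !inE vr orbT mulr0.
have := congr1 (fun z : L => ksign v r * z (v |: r)) dz.
rewrite !ffunE mulr0 mulr_sumr => /(congr1 -%R); rewrite oppr0 -sumrN => E0;
  rewrite -[RHS]E0.
rewrite [LHS](bigID (pred1 v)) /= [X in X + _]big1 ?add0r; last first.
  by move=> u /andP[_ /eqP->]; rewrite ffunE !inE eqxx /= mulr0.
apply: eq_big => [u|u /andP[ur uv]]; first by rewrite !inE negb_or andbC.
rewrite ffunE !inE vr eq_sym (negPf uv) /= [v |: _]setUCA.
transitivity (ksign u r * ksign v (u |: r) * ('X_u * z (u |: (v |: r))));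
  first by ring.
by rewrite ksign_swap ?vr //; ring.
Qed.

Lemma koszul_wedge v z : (forall r, v \in r -> z r = 0) ->
  koszul (wedge v z) = [ffun r : {set 'I_n} => 'X_v * z r] - wedge v (koszul z).
Proof.
move=> zv; apply/ffunP => r; rewrite !ffunE; case vr: (v \in r).
  rewrite zv // mulr0 sub0r [X in - (_ * X)](bigD1 v) ?setD11 //= setD1K // (zv
    r) // mulr0 add0r.
  rewrite mulr_sumr -sumrN; apply: eq_big => [u|u ur].
    by rewrite !inE negb_and negbK andb_orl; case: eqP => [->|_];
      rewrite ?vr ?andbF //= andbT.
  have uv : u != v by apply: contraNneq ur => ->.
  rewrite ffunE !inE vr orbT.
  have -> : (u |: r) :\ v = u |: (r :\ v).
    by apply/setP => x; rewrite !inE; case: eqP => // ->;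
      rewrite eq_sym (negPf uv).
  have urv : u \notin r :\ v by rewrite !inE (negPf ur) andbF.
  have := ksign_swap uv urv (negbT (setD11 v r)); rewrite setD1K // => E.
  transitivity (ksign u (r :\ v) * ksign v (u |: r :\ v) * (ksign u (r :\ v) *
    ksign u r)
      * ('X_u * z (u |: r :\ v))).
    by rewrite [ksign u (r :\ v) * _ * (_ * _)]mulrACA ksign_sqr; ring.
  rewrite E; transitivity (- ksign v (r :\ v) * ksign u (r :\ v)
      * ('X_u * z (u |: r :\ v)) * (ksign u r * ksign u r)).
    by ring.
  by rewrite ksign_sqr; ring.
rewrite subr0 (bigD1 v) ?vr //= big1 ?addr0 => [|u /andP[ur uv]].
  rewrite ffunE setU11 setU1K ?vr //.
  by rewrite mulrACA mulrCA ksign_sqr; ring.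
by rewrite ffunE !inE vr eq_sym (negPf uv) mulr0.
Qed.

Definition koszul_acyclic A := forall z, carried A z -> koszul z = 0 ->
  z set0 = 0 -> exists w, [/\ carried A w, w set0 = 0 & koszul w = z].

(** A degree 0 entry in the ideal of [A] is the boundary of a chain [w0] on singletons; subtracting
    that boundary reduces to [koszul_acyclic]. *)
Lemma koszul_acyclic_aug A z : koszul_acyclic A -> carried A z ->
  koszul z = 0 -> kill A (z set0) = 0 ->
  exists w, [/\ carried A w, w set0 = 0 & koszul w = z].
Proof.
move=> acA zA dz /kill_eq0E[h Eh].
pose w0 : L := [ffun r : {set 'I_n} => \sum_(v in A | r == [set v]) h v].
have w0A : carried A w0.
  move=> r rA; rewrite ffunE big1 // => v /andP[vA /eqP rv].
  by rewrite rv sub1set vA in rA.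
have w00 : w0 set0 = 0.
  by rewrite ffunE big1 // => v /andP[_ /eqP/setP/(_ v)]; rewrite !inE eqxx.
have dw0 : koszul w0 set0 = z set0.
  rewrite (koszul_set0 w0A) Eh; apply: eq_bigr => v vA; congr (_ * _).
  rewrite ffunE (big_pred1 v) // => u; rewrite /= (inj_eq set1_inj) eq_sym.
  by case: eqP => [->|]; rewrite ?vA ?andbF.
have [|||w1 [w1A w10 dw1]] := acA (z - koszul w0).
- move=> r rA; rewrite [LHS]ffunE [(- _ : L) _]ffunE zA //.
  by rewrite (koszul_carried w0A) // subr0.
- by rewrite koszulB dz koszul_koszul subrr.
- by rewrite [LHS]ffunE [(- _ : L) _]ffunE dw0 subrr.
exists (w0 + w1); split=> [r rA||]; last by rewrite koszulD dw1 addrC subrK.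
  by rewrite ffunE w0A ?w1A ?addr0.
by rewrite ffunE w00 w10 addr0.
Qed.

(** Induction on the size of [A], removing some [v]: write z = z' + e_v wedge c. Then c is a cycle
    free of e_v, so c = dw, and z + d(e_v wedge w) = z' + X_v w is a cycle free of e_v, hence a
    boundary. *)
Lemma koszul_exact A : koszul_acyclic A.
Proof.
have [m] := ubnP #|A|; elim: m A => // m IHm A.
rewrite ltnS => leAm z zA dz z0.
have [A0|[v vA]] := set_0Vmem A.
  exists 0; split=> [r _||]; rewrite ?ffunE // koszul0.
  apply/ffunP => r; rewrite ffunE.
  by have [->//|r0] := eqVneq r set0; rewrite zA // A0 subset0.
have acA' : koszul_acyclic (A :\ v).
  by apply: IHm; rewrite (leq_trans _ leAm) // [in X in (_ <= X)%N](cardsD1 v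
    A) vA.
have zvA : carried (A :\ v) (contraction v z).
  move=> r rA; rewrite ffunE; case: ifP => // vr; rewrite zA ?mulr0 //.
  apply: contra rA => /subsetP rA; apply/subsetP => u ur.
  by rewrite !inE rA ?inE ?ur ?orbT // andbT; apply: contraFneq vr => <-.
(* The degree 0 entry of [koszul z] puts X_v times that of the contraction in the prime ideal of
   [A :\ v], which does not contain X_v. *)
have [|w [wA w0 dw]] := koszul_acyclic_aug acA' zvA (koszul_contraction v dz).
  have := congr1 (fun z : L => kill (A :\ v) (z set0)) dz.
  rewrite (koszul_set0 zA) [(0 : L) _]ffunE kill0 (bigD1 v) //= killD killM
    killX !inE eqxx /=.
  rewrite (_ : kill _ (\sum_(_ in A | _) _) = 0) ?addr0 => [/eqP|]; last first.
    elim/big_ind: _ => [|x y x0 y0|u /andP[uA uv]];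
      rewrite ?kill0 ?killD ?x0 ?y0 ?addr0 //.
    by rewrite killM killX !inE uv uA mul0r.
  rewrite mulf_eq0 (negPf (mpolyX_neq0 _ _)) /= ffunE inE setU0 => /eqP.
  by rewrite killM => ->; rewrite mulr0.
have wv r : v \in r -> w r = 0.
  by move=> vr; apply: wA; apply/subsetPn; exists v; rewrite ?inE ?eqxx.
pose y := z + koszul (wedge v w).
have yE r : y r = if v \in r then 0 else z r + 'X_v * w r.
  rewrite ffunE (koszul_wedge wv) dw !ffunE; case vr: (v \in r);
    last by rewrite subr0.
  by rewrite wv // mulr0 sub0r !inE eqxx setD1K // mulrA ksign_sqr mul1r subrr.
have [|||w' [w'A w'0 dw']] := acA' y.
- move=> r rA; rewrite yE; case: ifP => // vr.
  rewrite wA // mulr0 addr0 zA //; apply: contra rA => rA.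
  by rewrite subsetD1 rA vr.
- by rewrite koszulD dz koszul_koszul addr0.
- by rewrite yE inE z0 w0 mulr0 addr0.
exists (w' - wedge v w); split=> [r rA||].
- rewrite !ffunE w'A; last by apply: contra rA => /subset_trans->//;
    apply: subsetDl.
  case: ifP => vr; last by rewrite subrr.
  rewrite wA ?mulr0 ?subrr //; apply: contra rA => rA.
  by rewrite -(setD1K vr) subUset sub1set vA (subset_trans rA) // subsetDl.
- by rewrite !ffunE w'0 inE subrr.
- by rewrite koszulB dw' addrK.
Qed.

End Koszul.

(** * The linear resolution *)

Section Resolution.
Import GRing.Theory.
Local Open Scope ring_scope.
Variables (F : fieldType) (n : nat) (A B : {set 'I_n}).
Hypothesis dAB : [disjoint A & B].
Local Notation S := {mpoly F[n]}.
Local Notation L := {ffun {set 'I_n} -> S}.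
Implicit Types (r : {set 'I_n}) (z w y : L) (u v : 'I_n).

Definition mixed r := [&& r \subset A :|: B, ~~ (r \subset A) & ~~ (r \subset
  B)].

Definition mixed_part z : L := [ffun r : {set 'I_n} =>
  if mixed r then z r else 0].

Definition mixed_carried z := forall r, ~~ mixed r -> z r = 0.

(* The connecting map of [0 -> K(A) + K(B) -> K(A :|: B) -> Q -> 0], where [Q]
   is spanned by the mixed subsets. *)
Definition connecting z : S := \sum_(a in A) 'X_a * koszul z [set a].

Lemma mixed_part_carried z : mixed_carried (mixed_part z).
Proof. by move=> r /negPf rm; rewrite ffunE rm. Qed.

Lemma mixed_carriedW z : mixed_carried z -> carried (A :|: B) z.
Proof. by move=> zm r rAB; apply: zm; rewrite /mixed (negPf rAB). Qed.

Lemma mixed1 v : ~~ mixed [set v].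
Proof. by rewrite /mixed !sub1set in_setU; case: (v \in A) => //=;
  rewrite andbN. Qed.

Lemma mixedU1 v r : v \in A :|: B -> mixed r -> mixed (v |: r).
Proof.
move=> vAB /and3P[rAB rA rB]; rewrite /mixed subUset sub1set vAB rAB /=.
by rewrite !subUset !negb_and rA rB !orbT.
Qed.

(** Every superset of a mixed set within [A :|: B] is mixed, so the discarded entries do not
    contribute. *)
Lemma koszul_mixed_part y r : carried (A :|: B) y -> mixed r ->
  koszul (mixed_part y) r = koszul y r.
Proof.
move=> yAB rm; rewrite !ffunE; apply: eq_bigr => v _; rewrite ffunE.
case: (boolP (v \in A :|: B)) => [vAB|vAB]; first by rewrite mixedU1.
have vr : ~~ (v |: r \subset A :|: B) by rewrite subUset sub1set negb_and vAB.
by rewrite /mixed (negPf vr) yAB.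
Qed.

(** Diagram chase: [koszul z] is p + q with p in K(A) and q in K(B). Both are cycles, hence
    boundaries of some p' and q', and z - p' - q' is a cycle of K(A :|: B), hence a boundary; p' and
    q' have no mixed entries. *)
Lemma mixed_exact z : mixed_carried z ->
  (forall r, mixed r -> koszul z r = 0) -> connecting z = 0 ->
  exists w, mixed_carried w /\ mixed_part (koszul w) = z.
Proof.
move=> zm dz cz; have zAB := mixed_carriedW zm.
have dz0 : koszul z set0 = 0.
  by rewrite (koszul_set0 zAB) big1 // => v _; rewrite zm ?mulr0 ?mixed1.
pose p : L := [ffun r : {set 'I_n} => if r \subset A then koszul z r else 0].
have [q Eq] : exists q : L, koszul z = p + q.
  by exists (koszul z - p); rewrite addrC subrK.
have qE r : q r = if r \subset A then 0 else koszul z r.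
  have -> : q = koszul z - p by rewrite Eq addrAC subrr add0r.
  by rewrite [LHS]ffunE [(- _ : L) _]ffunE [p r]ffunE; case: ifP;
    rewrite ?subrr ?subr0.
have pA : carried A p by move=> r /negPf rA; rewrite ffunE rA.
have qB : carried B q.
  move=> r rB; rewrite qE; case: ifPn => // rA.
  by case: (boolP (r \subset A :|: B)) => rAB; [apply: dz;
    apply/and3P | apply: koszul_carried rAB].
have dpq : koszul p + koszul q = 0 by rewrite -koszulD -Eq koszul_koszul.
(* [koszul p] and [koszul q] cancel and share only the entry at the empty set, which for [koszul p]
   is [connecting z]. *)
have dp : koszul p = 0.
  apply/ffunP => r; rewrite [RHS]ffunE.
  have [->|r0] := eqVneq r set0.
    rewrite (koszul_set0 pA) -[RHS]cz; apply: eq_bigr => a aA.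
    by rewrite ffunE sub1set aA.
  case: (boolP (r \subset A)) => rA; last exact: koszul_carried rA.
  have rB : ~~ (r \subset B).
    apply: contra r0 => rB; rewrite -subset0 -(disjoint_setI0 dAB).
    by rewrite subsetI rA.
  have := congr1 (fun z : L => z r) dpq.
  by rewrite [LHS]ffunE (koszul_carried qB rB) addr0 [RHS]ffunE.
have dq : koszul q = 0 by rewrite dp add0r in dpq.
have [|p' [p'A p'0 dp']] := koszul_exact pA dp; first by rewrite ffunE sub0set.
have [|q' [q'B q'0 dq']] := koszul_exact qB dq; first by rewrite qE sub0set.
have [|||w [wAB _ dw]] := @koszul_exact _ _ (A :|: B) (z - (p' + q')).
- move=> r rAB; rewrite !ffunE zAB // p'A ?q'B ?addr0 ?subrr //.
    by apply: contra rAB => /subset_trans->//; apply: subsetUr.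
  by apply: contra rAB => /subset_trans->//; apply: subsetUl.
- by rewrite koszulB koszulD dp' dq' -Eq subrr.
- by rewrite !ffunE p'0 q'0 zm ?addr0 ?subrr // /mixed !sub0set.
exists (mixed_part w); split; first exact: mixed_part_carried.
apply/ffunP => r; rewrite [LHS]ffunE; case: ifPn => rm; last by rewrite zm.
rewrite koszul_mixed_part // dw !ffunE; case/and3P: rm => _ rA rB.
by rewrite p'A // q'B // addr0 subr0.
Qed.

(** At singletons of [A] the differential of the mixed part of dw is -dy, where [y] is the part of
    dw in K(A); the connecting map thus gives the entry of -ddy at the empty set. *)
Lemma mixed_complex w : mixed_carried w ->
  connecting (mixed_part (koszul w)) = 0 /\
  forall r, mixed r -> koszul (mixed_part (koszul w)) r = 0.
Proof.
move=> /mixed_carriedW wAB; have dwAB := koszul_carried wAB.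
split=> [|r rm]; last by rewrite koszul_mixed_part // koszul_koszul ffunE.
pose y : L := [ffun r : {set 'I_n} => if r \subset A then koszul w r else 0].
have yA : carried A y by move=> r /negPf rA; rewrite ffunE rA.
have E a : a \in A -> koszul (mixed_part (koszul w)) [set a] = - koszul y [set
  a].
  move=> aA; apply/eqP; rewrite -addr_eq0; apply/eqP.
  have := congr1 (fun z : L => z [set a]) (koszul_koszul w).
  rewrite [RHS]ffunE => <-;
    rewrite [in LHS]ffunE [X in _ + X]ffunE -big_split /=.
  rewrite [RHS]ffunE; apply: eq_bigr => v _; rewrite -mulrDr; congr (_ * _).
  rewrite [mixed_part _ _]ffunE [y _]ffunE /mixed.
  case: (boolP (_ \subset A)) => [rA|rA]; first by rewrite andbF add0r.
  rewrite addr0 /=; case: (boolP (_ \subset A :|: B)) => [rAB|rAB];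
    last by rewrite dwAB.
  by rewrite subUset sub1set (disjointFr dAB aA) andbF.
rewrite /connecting; under eq_bigr => a aA do rewrite E // mulrN.
by rewrite sumrN -(koszul_set0 (koszul_carried yA)) koszul_koszul ffunE oppr0.
Qed.

Lemma koszul_mixed1 z a : mixed_carried z -> a \in A ->
  koszul z [set a] = \sum_(b in B) ksign F b [set a] * 'X_b * z (b |: [set a]).
Proof.
move=> zm aA; rewrite ffunE [LHS](bigID (mem B)) /= [X in _ + X]big1 ?addr0.
  apply: eq_bigl => b; rewrite inE andbC; case bB: (b \in B) => //=.
  by apply: contraTneq bB => ->; rewrite (disjointFr dAB aA).
move=> v /andP[_ vB]; rewrite zm ?mulr0 // /mixed !subUset !sub1set !in_setU.
by rewrite (negPf vB) aA; case: (v \in A).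
Qed.

(** On pairs the connecting map is, up to signs, the sum of the X_a X_b z({a, b}), so its image is
    spanned by the generators of the ideal. *)
Lemma bip_ideal_connecting f : bip_ideal A B f <->
  exists2 z, mixed_carried z /\ (forall r, #|r| != 2 ->
    z r = 0) & connecting z = f.
Proof.
split=> [/(bip_idealE dAB)[g ->]|[z [zm _] <-]]; last first.
  split; rewrite /connecting.
    elim/big_ind: _ => [|x y x0 y0|a aA];
      rewrite ?kill0 ?killD ?x0 ?y0 ?addr0 //.
    by rewrite killM killX aA mul0r.
  elim/big_ind: _ => [|x y x0 y0|a aA]; rewrite ?kill0 ?killD ?x0 ?y0 ?addr0 //.
  rewrite koszul_mixed1 // killM.
  rewrite [X in _ * X](_ : _ = 0) ?mulr0 //.
  elim/big_ind: _ => [|x y x0 y0|b bB]; rewrite ?kill0 ?killD ?x0 ?y0 ?addr0 //.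
  by rewrite !killM killX bB mulr0 mul0r.
pose z : L := [ffun r : {set 'I_n} =>
  \sum_(a in A) \sum_(b in B | r == [set b; a])
   ksign F b [set a] * g a b].
have zE r : (forall a b, a \in A -> b \in B -> r != [set b; a]) -> z r = 0.
  move=> rAB; rewrite ffunE big1 // => a aA; rewrite big1 // => b /andP[bB].
  by rewrite (negPf (rAB _ _ aA bB)).
have zm : mixed_carried z.
  move=> r rm; apply: zE => a b aA bB; apply: contraNneq rm => ->.
  rewrite /mixed !subUset !sub1set !in_setU aA bB orbT /=.
  by rewrite (disjointFr dAB aA) (disjointFl dAB bB).
exists z; first split=> // r r2.
  apply: zE => a b aA bB; apply: contraNneq r2 => ->.
  have ba : b != a by apply: contraTneq bB => ->; rewrite (disjointFr dAB aA).
  by rewrite cards2 ba.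
apply: eq_bigr => a aA; rewrite koszul_mixed1 // mulr_sumr;
  apply: eq_bigr => b bB.
have -> : z (b |: [set a]) = ksign F b [set a] * g a b.
  have ba : b != a by apply: contraTneq bB => ->; rewrite (disjointFr dAB aA).
  have eq_ba a' b' : a' \in A -> b' \in B -> [set b; a] = [set b';
    a'] -> a = a' /\ b = b'.
    move=> aA' bB' /setP E; split.
      move: (E a); rewrite !inE eqxx orbT => /esym/orP[/eqP ab'|/eqP//].
      by move: bB'; rewrite -ab' (disjointFr dAB aA).
    move: (E b); rewrite !inE eqxx => /esym/orP[/eqP//|/eqP ab'].
    by move: bB; rewrite ab' (disjointFr dAB aA').
  rewrite ffunE (bigD1 a) //= [X in _ + X]big1 ?addr0; last first.
    move=> a' /andP[a'A a'a];
      rewrite big1 // => b' /andP[b'B /eqP/eq_ba[]// Ea].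
    by rewrite Ea eqxx in a'a.
  rewrite (big_pred1 b) // => b'; rewrite /=;
    apply/andP/eqP => [[b'B /eqP/eq_ba[]//]|->].
  by rewrite eqxx.
transitivity ('X_a * 'X_b * g a b * (ksign F b [set a] * ksign F b [set a])).
  by ring.
by rewrite ksign_sqr mulr1.
Qed.


(** * The resolution in matrix form *)

Definition basis i : {set {set 'I_n}} :=
  if i is i'.+1 then [set r | mixed r & #|r| == i'.+2] else [set set0].

(** Splices the differential of Q with its map onto the ideal: the empty set indexes the free module
    of rank one at the end of the resolution. *)
Definition bdiff z r : S := if r == set0 then connecting z else koszul z r.

Definition basis_carried i z := forall r, r \notin basis i -> z r = 0.

Lemma basisS_neq0 i r : r \in basis i.+1 -> r != set0.
Proof. by rewrite inE => /andP[_]; apply: contraTneq => ->; rewrite cards0. Qed.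

Lemma basis_mixed_carried i z : basis_carried i.+1 z -> mixed_carried z.
Proof. by move=> zi r /negPf rm; apply: zi; rewrite inE rm. Qed.

Lemma koszul_basis i z r : basis_carried i.+1 z -> #|r| != i.+1 ->
  koszul z r = 0.
Proof.
move=> zi ri; rewrite ffunE big1 // => v vr; rewrite zi ?mulr0 //.
by rewrite inE cardsU1 vr eqSS (negPf ri) andbF.
Qed.

(** [mixed_exact] and [mixed_complex], one homological degree at a time; the conditions not visible
    in that degree hold because of the sizes of the sets. *)
Lemma basis_exact i z : basis_carried i.+1 z ->
  (forall r, r \in basis i -> bdiff z r = 0) <->
  exists2 w, basis_carried i.+2 w & forall r, r \in basis i.+1 ->
    z r = bdiff w r.
Proof.
move=> zi; have zm := basis_mixed_carried zi; split=> [dz|[w wi zE]].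
  have [||w [wm zE]] := mixed_exact zm.
  - move=> r rm; have [ri|] := eqVneq #|r| i.+1; last exact: koszul_basis.
    case: i zi dz ri => [|i] zi dz ri; last first.
      have rb : r \in basis i.+1 by rewrite inE rm ri eqxx.
      by have := dz r rb; rewrite /bdiff (negPf (basisS_neq0 rb)).
    by move/eqP/cards1P: ri rm => [v ->]; rewrite (negPf (mixed1 v)).
  - case: i zi dz => [|i] zi dz; first by have := dz set0;
      rewrite /bdiff eqxx set11; apply.
    by apply: big1 => a aA; rewrite (koszul_basis zi) ?mulr0 // cards1.
  (* On sets of size i + 2 the differential only sees the entries of [w] of size i + 3, so the
     others are dropped. *)
  exists [ffun r : {set 'I_n} => if r \in basis i.+2 then w r else 0].
    by move=> r /negPf ri; rewrite ffunE ri.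
  move=> r ri; rewrite /bdiff (negPf (basisS_neq0 ri)) -zE ffunE.
  move: ri; rewrite inE => /andP[rm /eqP ri]; rewrite rm !ffunE.
  apply: eq_bigr => v vr; rewrite ffunE inE cardsU1 vr ri eqxx andbT.
  by case: ifPn => // /wm ->.
have wm := basis_mixed_carried wi.
have -> : z = mixed_part (koszul w).
  apply/ffunP => r; rewrite ffunE; case: (boolP (r \in basis i.+1)) => ri.
    rewrite zE // /bdiff (negPf (basisS_neq0 ri)).
    by move: ri; rewrite inE => /andP[->].
  rewrite zi //; case: ifP => // rm; rewrite (koszul_basis wi) //.
  by move: ri; rewrite inE rm.
have [c0 d0] := mixed_complex wm; move=> r; rewrite /bdiff.
case: eqP => // r0; case: i {zi zE wi} => [|i]; first by move/set1P.
by rewrite inE => /andP[rm _]; apply: d0.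
Qed.

Definition bvec i (s : 'rV[S]_#|basis i|) : L :=
  [ffun r : {set 'I_n} => \sum_a s 0 a * (r == enum_val a)%:R].

Definition bcoord i z : 'rV[S]_#|basis i| := \row_a z (enum_val a).

Lemma bvecE i (s : 'rV_#|basis i|) a : bvec s (enum_val a) = s 0 a.
Proof.
rewrite ffunE (bigD1 a) //= eqxx mulr1 big1 ?addr0 // => b ba.
by rewrite (inj_eq enum_val_inj) eq_sym (negPf ba) mulr0.
Qed.

Lemma bvec_carried i (s : 'rV_#|basis i|) : basis_carried i (bvec s).
Proof.
move=> r ri; rewrite ffunE big1 // => a _; case: eqP => [ra|];
  last by rewrite mulr0.
by rewrite ra enum_valP in ri.
Qed.

Lemma bcoordK i z : basis_carried i z -> bvec (bcoord i z) = z.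
Proof.
move=> zi; apply/ffunP => r; case: (boolP (r \in basis i)) => ri.
  by rewrite -(enum_rankK_in ri ri) bvecE mxE.
by rewrite (bvec_carried _ ri) zi.
Qed.

Lemma bdiff_bvec i (s : 'rV_#|basis i|) r :
  bdiff (bvec s) r = \sum_a s 0 a * bdiff [ffun r' => (r' == enum_val a)%:R] r.
Proof.
have E r' : koszul (bvec s) r' =
    \sum_a s 0 a * koszul [ffun r' => (r' == enum_val a)%:R] r'.
  rewrite ffunE; under [RHS]eq_bigr do rewrite ffunE mulr_sumr.
  rewrite [RHS]exchange_big /=; apply: eq_bigr => v _.
  rewrite ffunE mulr_sumr; apply: eq_bigr => a _.
  by rewrite ffunE mulrCA.
rewrite /bdiff; case: eqP => // _.
rewrite /connecting; under [RHS]eq_bigr do rewrite mulr_sumr.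
rewrite [RHS]exchange_big /=; apply: eq_bigr => v _.
rewrite E mulr_sumr; apply: eq_bigr => a _.
by rewrite mulrCA.
Qed.

Definition bmx i : 'M[S]_(#|basis i.+1|, #|basis i|) :=
  \matrix_(a, b) bdiff [ffun r => (r == enum_val a)%:R] (enum_val b).

Lemma mul_bmx i (s : 'rV_#|basis i.+1|) b :
  (s *m bmx i) 0 b = bdiff (bvec s) (enum_val b).
Proof. by rewrite mxE bdiff_bvec; apply: eq_bigr => a _; rewrite mxE. Qed.

Lemma bmx_exact i (s : 'rV_#|basis i.+1|) :
  s *m bmx i = 0 <-> exists t, s = t *m bmx i.+1.
Proof.
have si := bvec_carried s; split=> [s0|[t Es]].
  have [|w wi sE] := (basis_exact si).1.
    by move=> r ri; rewrite -(enum_rankK_in ri ri) -mul_bmx s0 mxE.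
  exists (bcoord i.+2 w); apply/rowP => a.
  by rewrite mul_bmx bcoordK // -bvecE sE // enum_valP.
apply/rowP => b; rewrite mul_bmx mxE.
apply: (basis_exact si).2 (enum_valP b).
exists (bvec t); first exact: bvec_carried.
by move=> r ri; rewrite -(enum_rankK_in ri ri) -mul_bmx -Es bvecE.
Qed.

Lemma koszul_homog z r : (forall r, z r \is 0.-homog) ->
  koszul z r \is 1.-homog.
Proof.
move=> z0; rewrite ffunE rpred_sum // => v _; rewrite -[1%N]addn0.
apply: dhomogM => //; rewrite /ksign -signr_odd mulr_sign.
by case: ifP => _; rewrite ?rpredN dhomogX /= mdeg1.
Qed.

Lemma connecting_homog z : (forall r, z r \is 0.-homog) ->
  connecting z \is 2.-homog.
Proof.
move=> z0; rewrite rpred_sum // => a _; rewrite -[2%N]/(1 + 1)%N.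
by apply: dhomogM; [rewrite dhomogX /= mdeg1 | apply: koszul_homog].
Qed.

(** A basis set has its cardinality as degree: the connecting map is quadratic, from pairs to the
    empty set, and all further differentials are linear. *)
Lemma bmx_homog i a b m : m \in msupp (bmx i a b) ->
  (mdeg m + #|enum_val b| = #|enum_val a|)%N.
Proof.
rewrite mxE /bdiff; have := enum_valP a; rewrite inE => /andP[_ /eqP ->].
have delta0 r : [ffun r' : {set 'I_n} =>
  (r' == enum_val a)%:R : S] r \is 0.-homog.
  by rewrite ffunE; case: eqP => _; rewrite ?dhomog1 ?rpred0.
have bi := enum_valP b; case: eqP => [b0|/eqP b0].
  move/(dhomogP _ _ _ (connecting_homog delta0)) => /= ->; rewrite b0 cards0.
  case: i a b bi b0 {delta0} => // i a b /basisS_neq0/eqP b0 E.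
  by case: b0.
move/(dhomogP _ _ _ (koszul_homog _ delta0)) => /= ->.
case: i a b bi b0 {delta0} => [|i] a b; first by move/set1P=> ->; rewrite eqxx.
by rewrite inE => /andP[_ /eqP->].
Qed.

Lemma bmx0_exact (s : 'rV_#|basis 0|) :
  bip_ideal A B ((s *m const_mx 1 : 'M_1) 0 0) <-> exists t, s = t *m bmx 0.
Proof.
have E (a : 'I_#|basis 0|) : enum_val a = set0 :> {set 'I_n}.
  by have /set1P := enum_valP a.
have a0 : 'I_#|basis 0| by rewrite cards1; exact: ord0.
have all_a0 (a : 'I_#|basis 0|) : a = a0 by apply: enum_val_inj; rewrite !E.
have -> : (s *m const_mx 1 : 'M_1) 0 0 = s 0 a0.
  rewrite mxE (bigD1 a0) //= mxE mulr1 big1 ?addr0 // => a.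
  by rewrite (all_a0 a) eqxx.
split=> [/bip_ideal_connecting[z [zm z2] zE]|[t ->]].
  have zb : basis_carried 1 z.
    by move=> r; rewrite inE negb_and => /orP[/zm|/z2].
  exists (bcoord 1 z); apply/rowP => a.
  by rewrite mul_bmx bcoordK // E /bdiff eqxx zE (all_a0 a).
apply/bip_ideal_connecting; exists (bvec t);
  last by rewrite mul_bmx E /bdiff eqxx.
have tb := bvec_carried t; split; first exact: (basis_mixed_carried tb).
by move=> r r2; apply: tb; rewrite inE (negPf r2) andbF.
Qed.

(** For i at least 1 the i-th module has its basis in degree i + 1 alone, so Tor in any other degree
    is a subquotient of 0. *)
Lemma bip_linear_resolution (I : S -> Prop) :
  (forall f, I f <-> bip_ideal A B f) -> linear_resolution I.
Proof.
move=> IE; exists 2; split=> //; split.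
  move=> f; apply: iff_trans (IE f) (iff_trans (bip_generated_in_degree dAB f)
    _).
  by split; apply: ideal_gen_mono => g []/IE.
have aug_homog l : (const_mx 1 : 'cV[S]_#|basis 0|) l 0 \is #|enum_val
  l|.-homog.
  have /set1P-> := enum_valP l.
  by rewrite mxE cards0 dhomog1.
have aug_surj f : exists s : 'rV[S]_#|basis 0|,
    I (f - (s *m const_mx 1 : 'M_1) 0 0).
  exists (const_mx f); suff ->
    : ((const_mx f : 'rV[S]_#|basis 0|) *m const_mx 1 : 'M_1) 0 0 = f.
    by apply/IE; rewrite subrr; case: (bip_ideal_is_ideal F A B).
  rewrite mxE; under eq_bigr do rewrite !mxE mulr1.
  by rewrite sumr_const card_ord cards1.
pose R := GradedFreeResolution bmx_homog aug_homog aug_surj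
  (fun s => iff_trans (IE _) (bmx0_exact s)) bmx_exact.
case=> // i j _ ji; exists R; apply/eqP; rewrite /tor_dim -leqn0.
apply: leq_trans (leq_subr _ _) _; rewrite leqn0 mxrank_eq0 -submx0.
apply: submx_trans (capmxSl _ _) _; rewrite submx0 /tor_degree.
apply/eqP/matrixP => a b; rewrite !mxE.
have := enum_valP a; rewrite inE => /andP[_ /eqP da].
rewrite /= da (_ : _ == j = false) ?mul0rn //.
by apply/eqP => dj; apply: ji; rewrite -dj addnS subn1.
Qed.

End Resolution.

(** * Independent sets of cycles and wheels *)

Lemma mem_total_cut_complex n k (G : sgraph n) (A B : {set 'I_n}) :
  (forall M, independent G M && (#|M| == k) = (M == A) || (M == B)) ->
  forall N, (N \in faces (total_cut_complex k G)) =
    [disjoint N & A] || [disjoint N & B].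
Proof.
move=> indE N; rewrite inE; apply/existsP/orP => [[M]|].
  by rewrite andbA indE disjoints_subset disjoints_subset =>
    /andP[/orP[]/eqP-> ->]; [left|right].
case=> NM; [exists A|exists B];
  rewrite andbA indE eqxx ?orbT -disjoints_subset //.
Qed.

Section Cycle.
Variable k : nat.
Hypothesis k_gt0 : 0 < k.
Local Notation V := 'I_(2 * k).

Definition even_vertices : {set V} := [set i : V | ~~ odd i].
Local Notation E := even_vertices.

(** The length is even, so parity also flips at the wrap-around. *)
Lemma odd_ordS (i : V) : odd (ordS i) = ~~ odd i.
Proof. by rewrite /= odd_mod // mul2n odd_double. Qed.

(** The successor maps each parity class injectively into the other, so they have equal size. *)
Lemma card_even_vertices : #|E| = k /\ #|~: E| = k.
Proof.
have le_card (X Y : {set V}) : {in X, forall i, ordS i \in Y} -> #|X| <= #|Y|.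
  move=> XY; rewrite -(card_imset _ (@ordS_inj _)).
  by apply/subset_leq_card/subsetP => _ /imsetP[i iX ->]; apply: XY.
have eq_card : #|E| = #|~: E|.
  apply/eqP; rewrite eqn_leq !le_card // => i; by rewrite !inE odd_ordS ?negbK.
have := cardsC E; rewrite card_ord -eq_card addnn -mul2n => /eqP.
by rewrite eqn_mul2l => /eqP->.
Qed.

Lemma independent_even M : M = E \/ M = ~: E ->
  independent (cycle_graph (2 * k)) M.
Proof.
move=> ME; have parity i j : i \in M -> j \in M -> odd i = odd j.
  by case: ME => ->; rewrite !inE ?negbK => iM jM; rewrite ?iM ?jM //;
    rewrite (negPf iM) (negPf jM).
apply/forall_inP => i iM; apply/forall_inP => j jM.
rewrite /= /cycle_rel; apply/negP => /andP[_ /orP[]/eqP ij].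
  by have := parity _ _ iM jM; rewrite ij odd_ordS; case: odd.
by have := parity _ _ iM jM; rewrite ij odd_ordS; case: odd.
Qed.

(** For an independent [M] of size k the successor maps [M] into its complement, which also has size
    k; so membership alternates along the cycle and is determined at vertex 0. *)
Lemma independent_cycle M :
  independent (cycle_graph (2 * k)) M && (#|M| == k) = (M == E) || (M == ~: E).
Proof.
have [cE cO] := card_even_vertices.
apply/andP/orP => [[indM /eqP cM]|EM]; last first.
  have {}EM : M = E \/ M = ~: E by case: EM => /eqP; [left|right].
  by split; [exact: independent_even | case: EM => ->; rewrite ?cE ?cO].
have imM : @ordS _ @: M = ~: M.
  apply/eqP; rewrite eqEcard; apply/andP; split.
    apply/subsetP => _ /imsetP[i iM ->]; rewrite inE; apply/negP => iSM.
    have /forall_inP/(_ _ iM)/forall_inP/(_ _ iSM) := indM.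
    rewrite /= /cycle_rel eqxx andbT negbK => /eqP ii.
    by have := odd_ordS i; rewrite -ii; case: odd.
  rewrite card_imset; last exact: ordS_inj.
  by rewrite -(leq_add2l #|M|) cardsC card_ord cM addnn mul2n.
have MS i : (ordS i \in M) = (i \notin M).
  by rewrite -[LHS]negbK -in_setC -imM mem_imset //; exact: ordS_inj.
have n_gt0 : 0 < 2 * k by rewrite muln_gt0.
have ME m (ltm : m < 2 * k) : (Ordinal ltm \in M) = (Ordinal n_gt0 \in M) (+)
  odd m.
  elim: m ltm => [|m IHm] ltm;
    first by rewrite addbF (bool_irrelevance ltm n_gt0).
  rewrite (_ : Ordinal ltm = ordS (Ordinal (ltnW ltm))) ?MS ?IHm ?addbN //.
  by apply: val_inj; rewrite /= modn_small.
case M0: (Ordinal n_gt0 \in M) ME => ME; [left|right];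
  apply/eqP/setP => -[m ltm].
  by rewrite ME inE.
by rewrite ME !inE /= negbK.
Qed.

End Cycle.

(** * Cones and wheels *)

Lemma independent_cone n (G : sgraph n) (M : {set 'I_n}) :
  independent (cone_graph G) (lift ord_max @: M) = independent G M.
Proof.
have coneE a b : cone_graph G (lift ord_max a) (lift ord_max b) = G a b.
  by rewrite /= /cone_rel !liftK.
apply/forall_inP/forall_inP => indM.
  move=> a aM; apply/forall_inP => b bM; rewrite -coneE.
  by have /forall_inP := indM _ (imset_f _ aM); apply; apply: imset_f.
move=> _ /imsetP[a aM ->]; apply/forall_inP => _ /imsetP[b bM ->].
by rewrite coneE; have /forall_inP := indM _ aM; apply.
Qed.

(** The hub is adjacent to every other vertex, so an independent set with at least two elements
    avoids it and comes from [G]. *)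
Lemma independent_wheel k n (G : sgraph n) (A B : {set 'I_n}) : 1 < k ->
  (forall M, independent G M && (#|M| == k) = (M == A) || (M == B)) ->
  forall M, independent (cone_graph G) M && (#|M| == k) =
    (M == lift ord_max @: A) || (M == lift ord_max @: B).
Proof.
move=> k_gt1 indE M; have inj_lift := @lift_inj _ (@ord_max n).
apply/idP/orP => [/andP[indM /eqP cM]|AB]; last first.
  by case: AB => /eqP->; rewrite independent_cone card_imset // indE eqxx ?orbT.
have hubM : ord_max \notin M.
  apply/negP => hM; have : 1 < #|M| by rewrite cM.
  rewrite (cardsD1 ord_max) hM ltnS card_gt0 => /set0Pn[u];
    rewrite !inE => /andP[uh uM].
  have /forall_inP/(_ _ hM)/forall_inP/(_ _ uM) := indM.
  rewrite /= /cone_rel unlift_none; case: unliftP => //.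
  by move=> Eu; rewrite Eu eqxx in uh.
have EM : M = lift ord_max @: (lift ord_max @^-1: M).
  apply/setP => u; apply/idP/imsetP => [uM|[v + ->]]; last by rewrite inE.
  have [v Eu|Eu] := unliftP ord_max u; first by exists v; rewrite // inE -Eu.
  by rewrite -Eu uM in hubM.
have := indE (lift ord_max @^-1: M).
rewrite -independent_cone -(card_imset _ inj_lift) -EM indM cM eqxx =>
  /esym/orP[]/eqP E.
  by left; rewrite {1}EM E.
by right; rewrite {1}EM E.
Qed.

Theorem theorem24 (F : fieldType) (k : nat) (hk : (2 <= k)%N) :
  (linear_resolution
     (stanley_reisner_ideal F (total_cut_complex k (cycle_graph (2 * k)))) /\
   ~ cohen_macaulay
     (stanley_reisner_ideal F (total_cut_complex k (cycle_graph (2 * k))))) /\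
  (linear_resolution
     (stanley_reisner_ideal F (total_cut_complex k (wheel_graph (2 * k)))) /\
   ~ cohen_macaulay
     (stanley_reisner_ideal F (total_cut_complex k (wheel_graph (2 * k))))).
Proof.
have [cE cO] := card_even_vertices k.
have dEO : [disjoint even_vertices k & ~: even_vertices k].
  by rewrite disjoints_subset setCK.
have indE := independent_cycle (ltnW hk).
split.
  have IE := @stanley_reisner_bip F _ _ _ _ dEO (mem_total_cut_complex indE).
  split; first exact: (bip_linear_resolution dEO IE).
  by apply: (bip_not_cohen_macaulay2 IE dEO); rewrite ?cE ?cO ?setUCr.
have lift_inj := @lift_inj _ (@ord_max (2 * k)).
have dEO' : [disjoint lift ord_max @: even_vertices k & lift ord_max @: ~:
  even_vertices k].
  by rewrite imset_disjoint //; apply: in2W.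
have IE := @stanley_reisner_bip F _ _ _ _ dEO' (mem_total_cut_complex
  (independent_wheel hk indE)).
split; first exact: (bip_linear_resolution dEO' IE).
apply: (bip_not_cohen_macaulay3 (h := ord_max) IE dEO');
  rewrite ?card_imset ?cE ?cO //.
rewrite -imsetU setUCr; apply/setP => u; rewrite !inE.
case: (unliftP ord_max u) => [v ->|->].
  by rewrite imset_f // eq_sym (negPf (neq_lift _ _)).
rewrite eqxx; apply/imsetP => -[v _ hv].
by have := neq_lift ord_max v; rewrite -hv eqxx.
Qed.
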